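(* Let $n\ge 2$ and let $(\tau_1,\dots,\tau_{n-1})$ be a uniformly random decreasing factorisation of size $n$, with $\tau_i=(a_i\ b_i)$ and $a_i<b_i$. Then: 1. $\{b_1,\dots,b_{n-1}\}=\{2,3,\dots,n\}$ almost surely. 2. For all $k\in\{1,\dots,n-1\}$, $$\mathbb P\left(\#\{a_1,\dots,a_{n-1}\}=k\right)=\frac{n+1}{n-1}\binom{n-1}{k}\binom{n-1}{k-1}\binom{2n}{n}^{-1}.$$ 3. As $n\to\infty$, the convergence $$\frac{\#\{a_1,\dots,a_{n-1}\}-n/2}{\sqrt n}\longrightarrow \mathcal N(0,1/8)$$ holds in distribution, where $\mathcal N(0,1/8)$ denotes a centered normal distribution with variance $1/8$.
   Context: A minimal factorisation of size $n\ge 2$ is a tuple $(\tau_1,\dots,\tau_{n-1})$ of transpositions of $\{1,\dots,n\}$ such that $\tau_{n-1}\circ\dots\circ\tau_1=(1\ 2\ \dots\ n)$ (the $n$-cycle $1\mapsto2\mapsto\dots\mapsto n\mapsto1$; $\tau_1$ is applied first). Writing $\tau_i=(a_i\ b_i)$ with $a_i<b_i$, it is a decreasing factorisation if $a_1\ge a_2\ge\dots\ge a_{n-1}$ (weakly decreasing). The set of decreasing factorisations of size $n$ is finite; ''uniformly random'' means uniform on this set. $\#A$ denotes the cardinality of $A$.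
   Formalization: In item 2 the probability is stated as n/(n-1) * C(n-1,k) * C(n-1,k-1) / C(2n-2,n-1); the printed formula with (n+1)/(n-1) and C(2n,n) is false (for n=2, k=1 it gives 1/2, while the true probability is 1). *)

(* Defs.v *)
From HB Require Import structures.
From mathcomp Require Import all_boot all_order all_algebra all_fingroup.
From mathcomp Require Import all_classical all_reals all_analysis.

Set Implicit Arguments.
Unset Strict Implicit.
Unset Printing Implicit Defensive.

Import Order.TTheory GRing.Theory Num.Theory.
Import numFieldNormedType.Exports.

Local Open Scope classical_set_scope.
Local Open Scope ring_scope.

Definition transposition n (s : {perm 'I_n}) : bool :=
  [exists x, exists y, (x != y) && (s == tperm x y)].

(* The element i : 'I_n carries the label i.+1, so that labels range over
   {1, ..., n}. For a transposition s = (a b) with a < b, lo s and hi s are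
   the labels a and b, as lo_tperm and hi_tperm show; other permutations get
   irrelevant values. *)
Definition lo n (s : {perm 'I_n}) : nat := \big[minn/n]_(i | s i != i) i.+1.
Definition hi n (s : {perm 'I_n}) : nat := (\max_(i | s i != i) i.+1)%N.

Lemma tperm_moved n (a b i : 'I_n) : (a < b)%N ->
  (tperm a b i != i) = (i == a) || (i == b).
Proof.
move=> ab; have nab : a != b by rewrite neq_ltn ab.
by case: tpermP => [->|->|/eqP/negPf-> /eqP/negPf->];
  rewrite ?eqxx ?orbT // eq_sym.
Qed.

Lemma lo_tperm n (a b : 'I_n) : (a < b)%N -> lo (tperm a b) = a.+1.
Proof.
move=> ab; rewrite /lo; apply/eqP; rewrite eqn_leq; apply/andP; split.
  by rewrite (bigminD1 a) ?geq_minl // tperm_moved // eqxx.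
elim/big_ind: _ => [|x y hx hy|i]; first exact: ltn_ord.
  by rewrite leq_min hx.
by rewrite tperm_moved // => /orP[]/eqP-> //; exact: ltnW.
Qed.

Lemma hi_tperm n (a b : 'I_n) : (a < b)%N -> hi (tperm a b) = b.+1.
Proof.
move=> ab; rewrite /hi; apply/eqP; rewrite eqn_leq; apply/andP; split.
  apply/bigmax_leqP => i; rewrite tperm_moved // => /orP[]/eqP-> //.
  exact: ltnW.
by apply: (@leq_bigmax_cond _ _ (fun i : 'I_n => i.+1) b); rewrite tperm_moved // eqxx orbT.
Qed.

Definition long_cycle n : {perm 'I_n} := perm (@ordS_inj n).

Definition perm_tuple n : Type := (n.-1).-tuple {perm 'I_n}.

HB.instance Definition _ n := Finite.on (perm_tuple n).
HB.instance Definition _ n := isPointed.Build (perm_tuple n)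
  (nseq_tuple n.-1 (1%g : {perm 'I_n})).
HB.instance Definition _ n := @isMeasurable.Build default_measure_display
  (perm_tuple n) discrete_measurable discrete_measurable0
  discrete_measurableC discrete_measurableU.

(* In a product of permutations the leftmost factor is applied first, so the
   product below is tau_(n-1) o ... o tau_1. *)
Definition minimal_factorization n (t : perm_tuple n) : bool :=
  all (@transposition n) t && ((\prod_(s <- t) s)%g == long_cycle n).

Definition a_values n (t : perm_tuple n) : seq nat := [seq lo s | s <- t].
Definition b_values n (t : perm_tuple n) : seq nat := [seq hi s | s <- t].

Definition decreasing_factorization n (t : perm_tuple n) : bool :=
  minimal_factorization t && sorted geq (a_values t).

Definition nb_a_values n (t : perm_tuple n) : nat := size (undup (a_values t)).

Definition uniform_decreasing_factorization (R : realType) d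
    (T : measurableType d) (P : probability T R) n
    (tau : {RV P >-> perm_tuple n}) : Prop :=
  forall t : perm_tuple n, distribution P tau [set t] =
    (if decreasing_factorization t
     then #|[set u | @decreasing_factorization n u]%SET|%:R^-1 else 0)%:E.

Definition normalized_nb_a_values (R : realType) n (t : perm_tuple n) : R :=
  ((nb_a_values t)%:R - n%:R / 2) / Num.sqrt n%:R.

HB.instance Definition _ (R : realType) n :=
  isMeasurableFun.Build _ _ (perm_tuple n) R (@normalized_nb_a_values R n)
    (fun _ _ _ => I).

Definition cvg_in_distribution (R : realType) (d : nat -> measure_display)
    (T : forall n, measurableType (d n)) (P : forall n, probability (T n) R)
    (X : forall n, {RV (P n) >-> R})
    (mu : probability (measurableTypeR R) R) : Prop :=
  forall x : R, {for x, continuous (fun y : R => mu `]-oo, y]%classic)} ->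
    cdf (X n) x @[n --> \oo] --> mu `]-oo, x]%classic.

(* Main.v *)
Require Import Defs.
From mathcomp Require Import all_boot all_order all_algebra all_fingroup.
From mathcomp Require Import all_classical all_reals all_analysis.
From mathcomp Require Import measurable_realfun zify ring lra.

Set Implicit Arguments.
Unset Strict Implicit.
Unset Printing Implicit Defensive.

(** In a decreasing factorisation of the cycle (i i+1 ... i+m) the last factor is
    (i b) for some b.  A graph on m+1 vertices with m-1 edges has at least two
    components, so no other factor joins [i, b-1] to [b, i+m]; by monotonicity
    the other factors are a factorisation of (b ... i+m) followed by one of
    (i ... b-1).  Marking the number of distinct a's by X, the generating series
    W therefore satisfies W = 1 + z W^2 + (X - 1) z W, and the coefficient of
    X^(k+1) z^s in W^h is h/(k+1) C(h+s-1,k) C(s-1,k) for s > 0; h = 1 gives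
    the law of the number of distinct a's.  For the limit law, the inequality
    1 + x <= exp x applied to quotients of consecutive weights C(N,j+1) C(N,j)
    squeezes each weight, relative to the central one, between two Gaussian
    expressions.  The weights are then read as values of step functions, which
    converge pointwise to exp(-4 t^2) and are dominated by a multiple of
    exp(-t^2). *)

(** * Decreasing factorisations of a cycle of consecutive integers *)

Section DecreasingLists.

Definition swap (e : nat * nat) (x : nat) : nat :=
  if x == e.1 then e.2 else if x == e.2 then e.1 else x.

(* As for permutations, the head of the list is applied first. *)
Definition run (l : seq (nat * nat)) (x : nat) : nat :=
  foldl (fun y e => swap e y) x l.

(** Total on the naturals, with fixed points outside the interval, so that cycles on nested
    intervals compose without a change of type. *)
Definition interval_cycle (i m x : nat) : nat :=
  if i <= x < i + m then x.+1 else if x == i + m then i else x.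

Definition edge_in (i m : nat) (e : nat * nat) : bool :=
  [&& i <= e.1, e.1 < e.2 & e.2 <= i + m].

Definition cycle_factors (i m : nat) (l : seq (nat * nat)) : Prop :=
  [/\ all (edge_in i m) l, size l = m, sorted geq (unzip1 l)
    & run l =1 interval_cycle i m].

Definition compatible (l : seq (nat * nat)) (f : nat -> nat) : Prop :=
  forall e : nat * nat, e \in l -> f e.1 = f e.2.

Lemma swapK e : involutive (swap e).
Proof.
move=> x; rewrite /swap; case: (eqVneq x e.1) => [->|x1].
  by rewrite eqxx; case: eqP.
case: (eqVneq x e.2) => [->|x2]; first by rewrite eqxx.
by rewrite (negPf x1) (negPf x2).
Qed.

Lemma run_cat l1 l2 x : run (l1 ++ l2) x = run l2 (run l1 x).
Proof. by rewrite /run foldl_cat. Qed.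

Lemma run_rcons l e x : run (rcons l e) x = swap e (run l x).
Proof. by rewrite -cats1 run_cat. Qed.

Lemma run_compatible l f x : compatible l f -> f (run l x) = f x.
Proof.
elim: l x => [//|e l IH] x lf /=; rewrite /run /= -/(run l _) IH; last first.
  by move=> e' e'l; apply: lf; rewrite inE e'l orbT.
have fe := lf e (mem_head _ _); rewrite /swap.
by have [->|_] := eqVneq x e.1; last by have [->|//] := eqVneq x e.2.
Qed.

Lemma run_fix l x : (forall e : nat * nat, e \in l -> (x != e.1) && (x != e.2)) -> run l x = x.
Proof.
elim: l x => [//|e l IH] x H; rewrite /run /= -/(run l _).
have /andP[/negPf x1 /negPf x2] := H e (mem_head _ _).
by rewrite {1}/swap x1 x2 IH // => e' e'l; apply: H; rewrite inE e'l orbT.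
Qed.

(* A graph with [size l] edges has at least [size s - size l] components;
   [f] labels the components. *)
Lemma many_components l (s : seq nat) : uniq s ->
  exists2 f, compatible l f & size s <= size (undup (map f s)) + size l.
Proof.
move=> us; elim: l => [|e l [f fl sf]].
  by exists id => //; rewrite map_id undup_id // addn0.
(* The new edge merges the component of [e.1] into that of [e.2], so only the label [f e.1] can
   disappear. *)
exists (fun x => if f x == f e.1 then f e.2 else f x).
  move=> e'; rewrite inE => /orP[/eqP->|/fl->//].
  by rewrite eqxx; case: ifP.
rewrite /= addnS -addSn (leq_trans sf) // leq_add2r.
set L := map f s; set c := f e.1; set L' := map _ s.
have H : size (seq.filter (predC1 c) (undup L)) <= size (undup L').
  apply: uniq_leq_size; first by rewrite filter_uniq // undup_uniq.
  move=> y; rewrite mem_filter !mem_undup => /andP[/= yc /mapP[x xs yx]].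
  by apply/mapP; exists x => //; rewrite -yx (negPf yc).
have := count_predC (pred1 c) (undup L).
rewrite -(size_filter (predC _)) count_uniq_mem ?undup_uniq //.
move: H; rewrite -[[seq x <- _ | predC _ x]]/([seq x <- undup L | predC1 c x]).
by move=> H1 <-; rewrite -add1n; apply: leq_add H1; case: (_ \in _).
Qed.

Lemma size_undup_le (s t : seq nat) : {subset s <= t} -> size (undup s) <= size t.
Proof.
by move=> st; apply: uniq_leq_size (undup_uniq s) _ => x; rewrite mem_undup => /st.
Qed.

(** Component labels are invariant under [run l], and the cycle carries [i] successively to every
    point of the interval. *)
Lemma cycle_compatible l f i m x : compatible l f ->
  {in [pred x | i <= x <= i + m], run l =1 interval_cycle i m} ->
  i <= x <= i + m -> f x = f i.
Proof.
move=> lf rl /andP[ix xm].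
have: x - i <= m by lia.
have -> : x = i + (x - i) by lia.
elim: (x - i) => [|k IH] km; first by rewrite addn0.
rewrite -IH; last by lia.
rewrite -(run_compatible (i + k) lf) rl; last by rewrite inE; lia.
by congr f; rewrite /interval_cycle ifT; lia.
Qed.

(** The m+1 points moved by the cycle lie in one component, and connecting them takes m edges. *)
Lemma cycle_size l i m :
  {in [pred x | i <= x <= i + m], run l =1 interval_cycle i m} -> m <= size l.
Proof.
move=> rl; have [f lf] := @many_components l (iota i m.+1) (iota_uniq _ _).
rewrite size_iota.
have : size (undup (map f (iota i m.+1))) <= size [:: f i].
  apply: size_undup_le => y /mapP[x]; rewrite mem_iota => xi ->.
  by rewrite inE (cycle_compatible lf rl) //; lia.
by rewrite /=; lia.
Qed.

Lemma sorted_geq_split b (l : seq (nat * nat)) : sorted geq (unzip1 l) ->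
  l = [seq e <- l | b <= e.1] ++ [seq e <- l | e.1 < b].
Proof.
elim: l => [//|e l IH] /= sl.
case: (leqP b e.1) => be; first by rewrite /= -IH // (path_sorted sl).
have /allP al := order_path_min (rev_trans leq_trans) sl.
have lb e' : e' \in l -> e'.1 < b.
  by move=> e'l; have := al _ (map_f fst e'l); rewrite /=; lia.
rewrite (eq_in_filter (a2 := pred0)); last by move=> e' /lb /=; lia.
rewrite filter_pred0 /=; congr cons.
by rewrite (eq_in_filter (a2 := predT)) ?filter_predT // => e' /lb /= ->.
Qed.

Section Split.
Variables (i p q : nat) (l : seq (nat * nat)).
Let b := i + p.+1.
Hypothesis l_in : all (edge_in i (p + q).+1) l.
Hypothesis l_size : size l = p + q.
Hypothesis l_sorted : sorted geq (unzip1 l).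
Hypothesis l_low : {in [pred x | x < b], run l =1 interval_cycle i p}.
Hypothesis l_high : {in [pred x | b <= x], run l =1 interval_cycle b q}.

Let low_in : {in [pred x | i <= x <= i + p], run l =1 interval_cycle i p}.
Proof. by move=> x; rewrite inE => xi; apply: l_low; rewrite inE /b; lia. Qed.

Let high_in : {in [pred x | b <= x <= b + q], run l =1 interval_cycle b q}.
Proof. by move=> x; rewrite inE => xi; apply: l_high; rewrite inE /b; lia. Qed.

(** An edge across [b] would join the two cycles into one component of p+q+2 points, while p+q edges
    leave at least two components. *)
Lemma no_crossing (e : nat * nat) : e \in l -> (e.2 < b) || (b <= e.1).
Proof.
move=> el; have /allP/(_ _ el)/and3P[ie1 e12 e2] := l_in.
apply: contraT; rewrite negb_or -leqNgt -ltnNge => /andP[be2 e1b].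
have [f lf] := @many_components l (iota i (p + q).+2) (iota_uniq _ _).
rewrite size_iota.
have fib : f i = f b.
  rewrite -(cycle_compatible (x := e.1) lf low_in); last by lia.
  by rewrite (lf _ el) (cycle_compatible lf high_in) //; lia.
have : size (undup (map f (iota i (p + q).+2))) <= size [:: f i].
  apply: size_undup_le => y /mapP[x]; rewrite mem_iota => xi ->; rewrite inE.
  have [xb|bx] := ltnP x b.
    by rewrite (cycle_compatible lf low_in) //; lia.
  by rewrite fib (cycle_compatible lf high_in) //; lia.
by rewrite /= l_size; lia.
Qed.

Lemma split_factors : exists r l',
  [/\ l = r ++ l', cycle_factors b q r & cycle_factors i p l'].
Proof.
pose r := [seq e <- l | b <= e.1]; pose l' := [seq e <- l | e.1 < b].
have lE : l = r ++ l' by exact: sorted_geq_split.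
have r_in : all (edge_in b q) r.
  apply/allP => e; rewrite mem_filter => /andP[be /(allP l_in)].
  by rewrite /edge_in /b in be *; lia.
have l'_in : all (edge_in i p) l'.
  apply/allP => e; rewrite mem_filter => /andP[be el].
  have := no_crossing el; have /(allP l_in) := el.
  by rewrite /edge_in /b in be *; lia.
have r_run x : x < b -> run r x = x.
  by move=> xb; apply: run_fix => e /(allP r_in); rewrite /edge_in; lia.
have l'_run x : b <= x -> run l' x = x.
  move=> xb; apply: run_fix => e /(allP l'_in); rewrite /edge_in.
  by rewrite /b in xb; lia.
have r_cyc : run r =1 interval_cycle b q.
  move=> x; have [xb|bx] := ltnP x b.
    by rewrite r_run // /interval_cycle ifF ?ifF //; lia.
  have rb : compatible r (fun x => b <= x).
    by move=> e /(allP r_in); rewrite /edge_in; lia.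
  rewrite -l_high ?inE // lE run_cat l'_run //.
  by have := run_compatible x rb; rewrite bx; case: (b <= _).
have l'_cyc : run l' =1 interval_cycle i p.
  move=> x; have [xb|bx] := ltnP x b.
    by rewrite -l_low ?inE // lE run_cat r_run.
  rewrite (l'_run _ bx) /interval_cycle; rewrite /b in bx.
  by rewrite ifF ?ifF //; lia.
have := l_size; rewrite {1}lE size_cat => sz.
(* Both lengths are bounded below by [cycle_size] and add up to [p + q], so both bounds are
   equalities. *)
have rq : q <= size r by apply: (@cycle_size r b); apply: in1W; exact: r_cyc.
have l'p : p <= size l' by apply: (@cycle_size l' i); apply: in1W; exact: l'_cyc.
have := l_sorted; rewrite {1}lE /unzip1 map_cat => /cat_sorted2[sr sl'].
by exists r, l'; split=> //; split=> //; lia.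
Qed.

End Split.

Lemma cycle_factorsS i m l : cycle_factors i m.+1 l <->
  exists p r l', [/\ p <= m, l = r ++ rcons l' (i, i + p.+1),
    cycle_factors (i + p.+1) (m - p) r & cycle_factors i p l'].
Proof.
split=> [[]|[p [r [l' [pm ->]]]]].
  case: (lastP l) => [//|l0 [a b]]; rewrite all_rcons size_rcons /edge_in /=.
  move=> /andP[/and3P[ia ab bm] l0_in] [l0_size] l0_sorted l_run.
  (* The last factor has the smallest start; were it above [i], no factor would touch [i], which the
     cycle moves. *)
  have ai : a = i.
    apply/eqP; rewrite eqn_leq ia andbT leqNgt; apply/negP => ltia.
    have : run (rcons l0 (a, b)) i = i.
      apply: run_fix => e; rewrite mem_rcons inE => /orP[/eqP->/=|el0]; first by lia.
      have /allP/(_ _ el0) := l0_in; rewrite /edge_in.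
      move: l0_sorted; rewrite /unzip1 map_rcons -rev_sorted rev_rcons /=.
      move/(order_path_min leq_trans)/allP/(_ e.1).
      by rewrite mem_rev map_f // => /(_ isT); lia.
    by rewrite l_run /interval_cycle ifT; lia.
  have [p pm bE] : exists2 p, p <= m & b = i + p.+1 by exists (b - i).-1; lia.
  subst a b.
  (* Undoing the last factor cuts the long cycle into the cycles of [i, i+p] and [i+p+1, i+m+1], as
     [split_factors] requires. *)
  have l0_run x : run l0 x = swap (i, i + p.+1) (interval_cycle i m.+1 x).
    by rewrite -l_run run_rcons swapK.
  have mE : m = p + (m - p) by lia.
  have /cat_sorted2[l0s _] : sorted geq (unzip1 l0 ++ [:: i]).
    by move: l0_sorted; rewrite /unzip1 map_rcons cats1.
  have [|||||r [l' [-> fr fl']]] := @split_factors i p (m - p) l0.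
  - by rewrite -mE.
  - by rewrite -mE.
  - by [].
  - move=> x; rewrite inE => xb; rewrite l0_run /swap /interval_cycle /=.
    by repeat case: ifP; lia.
  - move=> x; rewrite inE => xb; rewrite l0_run /swap /interval_cycle /=.
    by repeat case: ifP; lia.
  by exists p, r, l'; rewrite rcons_cat.
move=> [r_in r_size r_sorted r_run] [l'_in l'_size l'_sorted l'_run]; split.
- rewrite all_cat all_rcons; apply/and3P; split.
  + by apply: sub_all r_in => e; rewrite /edge_in; lia.
  + by rewrite /edge_in /=; lia.
  + by apply: sub_all l'_in => e; rewrite /edge_in; lia.
- by rewrite size_cat size_rcons; lia.
- rewrite (@sorted_pairwise _ geq (rev_trans leq_trans)).
  rewrite /unzip1 map_cat map_rcons pairwise_cat pairwise_rcons.
  rewrite -!(@sorted_pairwise _ geq (rev_trans leq_trans)).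
  apply/and3P; split => //.
  + rewrite /allrel; apply/allP => _ /mapP[e /(allP r_in) er ->].
    apply/allP => x; rewrite mem_rcons inE => /orP[/eqP->|/mapP[e' /(allP l'_in) er' ->]];
    by rewrite /edge_in /= in er *; try rewrite /edge_in in er'; lia.
  + apply/andP; split => //; apply/allP => _ /mapP[e /(allP l'_in) er ->].
    by rewrite /edge_in /= in er *; lia.
- move=> x; rewrite run_cat run_rcons r_run l'_run /swap /interval_cycle /=.
  by repeat case: ifP; lia.
Qed.

Lemma cycle_factors0 i l : cycle_factors i 0 l <-> l = [::].
Proof.
split=> [[_ /size0nil//]|->]; split=> // x.
by rewrite /run /= /interval_cycle ifF; [case: eqP; lia|lia].
Qed.

End DecreasingLists.

(** * Enumeration by the number of distinct starts *)

Section Enumeration.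

(* Peeling off the last factor [(i, i + p.+1)] splits a factorisation; [k] is
   only recursion fuel. *)
Fixpoint cycle_factors_list (k i m : nat) : seq (seq (nat * nat)) :=
  match m, k with
  | 0, _ => [:: [::]]
  | m'.+1, k'.+1 =>
      [seq u.1 ++ rcons u.2 (i, i + p.+1) | p <- iota 0 m'.+1,
         u <- [seq (r, l) | r <- cycle_factors_list k' (i + p.+1) (m' - p),
                            l <- cycle_factors_list k' i p]]
  | _, 0 => [::]
  end.

Lemma cycle_factors_listS k i m : cycle_factors_list k.+1 i m.+1 =
  [seq u.1 ++ rcons u.2 (i, i + p.+1) | p <- iota 0 m.+1,
     u <- [seq (r, l) | r <- cycle_factors_list k (i + p.+1) (m - p),
                        l <- cycle_factors_list k i p]].
Proof. by []. Qed.

Lemma mem_cycle_factors_list k i m l : m <= k ->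
  l \in cycle_factors_list k i m <-> cycle_factors i m l.
Proof.
elim: k i m l => [|k IH] i [|m] l // mk.
- by rewrite inE cycle_factors0; split=> [/eqP|->].
- by rewrite inE cycle_factors0; split=> [/eqP|->].
rewrite cycle_factors_listS cycle_factorsS; split.
  move=> /allpairsPdep[p [_ [pm /allpairsP[[r l'] [/= rin lin ->]] ->]]] /=.
  rewrite mem_iota in pm.
  by exists p, r, l'; split; [lia|by []|apply/IH; [lia|]..].
move=> [p [r [l' [pm -> fr fl]]]]; apply/allpairsPdep; exists p, (r, l'); split=> //.
  by rewrite mem_iota; lia.
by apply/allpairsP; exists (r, l'); split=> //; apply/IH => //; lia.
Qed.

Lemma cycle_factors_list_uniq k i m : m <= k -> uniq (cycle_factors_list k i m).
Proof.
elim: k i m => [|k IH] i [|m] // mk.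
rewrite cycle_factors_listS; apply: allpairs_uniq_dep; first exact: iota_uniq.
  move=> p; rewrite mem_iota => pm.
  by apply: allpairs_uniq => [||[? ?] [? ?] _ _ [-> ->] //]; apply: IH; lia.
move=> x y /allpairsPdep[p [[r l] [pm /allpairsP[[r1 l1] [rin lin [-> ->]]] ->]]].
move=> /allpairsPdep[q [[s t] [qm /allpairsP[[s1 t1] [sin tin [-> ->]]] ->]]].
rewrite /= in rin lin sin tin *.
rewrite !mem_iota in pm qm; rewrite -!rcons_cat => /rcons_inj[e1 e2].
have pq : p = q by lia.
(* The last factor has determined p; the length [m - p] of the first block then fixes where the rest
   is cut. *)
subst q; have /eqP := e1; rewrite eqseq_cat; first by move=> /andP[/eqP-> /eqP->].
have [||[_ -> _ _]] // := (@mem_cycle_factors_list k (i + p.+1) (m - p) r1 _).1; first by lia.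
by have [||[_ -> _ _]] // := (@mem_cycle_factors_list k (i + p.+1) (m - p) s1 _).1; lia.
Qed.

(** By recursion: the ends above, at and below i+p+1 come from [r], from the last factor and from
    [l'] respectively. *)
Lemma mem_unzip2_cycle_factors i m l : cycle_factors i m l ->
  unzip2 l =i [pred b | i < b <= i + m].
Proof.
have [k] := ubnP m; elim: k i m l => [//|k IH] i [|m] l mk.
  by move/cycle_factors0 => -> b; rewrite /=; rewrite !inE ?in_nil; lia.
move/cycle_factorsS => [p [r [l' [pm -> fr fl]]]] b.
rewrite /unzip2 map_cat mem_cat map_rcons mem_rcons inE.
have -> := IH _ _ _ _ fr; last by lia.
have -> := IH _ _ _ _ fl; last by lia.
by rewrite !inE /=; lia.
Qed.

Definition distinct_starts (l : seq (nat * nat)) : nat := size (undup (unzip1 l)).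

(** The starts in [r] exceed all others. The start i of the last factor is new only when p = 0,
    since a nonempty [l] itself ends with a factor starting at i. *)
Lemma distinct_startsS i p q r l :
  cycle_factors (i + p.+1) q r -> cycle_factors i p l ->
  distinct_starts (r ++ rcons l (i, i + p.+1)) =
  distinct_starts r + (distinct_starts l + (p == 0)).
Proof.
move=> [r_in _ _ _] fl; have [l_in _ _ _] := fl.
rewrite /distinct_starts /unzip1 map_cat map_rcons undup_cat size_cat.
rewrite -!/(unzip1 _) /=; congr addn.
  congr size; apply/all_filterP/allP => x; rewrite mem_undup => /mapP[e er ->] /=.
  rewrite mem_rcons inE negb_or; have /allP/(_ _ er) := r_in.
  rewrite /edge_in => ein; apply/andP; split; first by apply/eqP; lia.
  by apply/negP => /mapP[e' /(allP l_in)]; rewrite /edge_in; lia.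
case: p fl {r_in l_in} => [/cycle_factors0->//|p].
move=> /cycle_factorsS[p' [r' [l' [_ -> _ _]]]]; rewrite addn0.
apply/perm_size/uniq_perm; rewrite ?undup_uniq // => x.
rewrite !mem_undup mem_rcons inE /unzip1 map_cat map_rcons mem_cat mem_rcons inE /=.
by case: (x == i); rewrite ?orbT.
Qed.

Local Open Scope ring_scope.
Import GRing.Theory.

Definition starts_poly (s : seq (seq (nat * nat))) : {poly rat} :=
  \sum_(l <- s) 'X^(distinct_starts l).

Lemma coef_starts_poly s k :
  (starts_poly s)`_k = (count (fun l => distinct_starts l == k) s)%:R.
Proof.
rewrite /starts_poly coef_sum -sum1_count natr_sum [RHS]big_mkcond /=.
by apply: eq_bigr => l _; rewrite coefXn eq_sym; case: eqP.
Qed.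

Lemma starts_polyS k i m :
  (m <= k)%N ->
  starts_poly (cycle_factors_list k.+1 i m.+1) =
  \sum_(0 <= p < m.+1) starts_poly (cycle_factors_list k i p) *
     (if p == 0%N then 'X else 1) * starts_poly (cycle_factors_list k (i + p.+1) (m - p)).
Proof.
move=> mk; rewrite /starts_poly cycle_factors_listS big_allpairs_dep.
rewrite /index_iota subn0.
apply: eq_big_seq => p; rewrite mem_iota => pm.
rewrite big_allpairs_dep exchange_big /= mulr_suml big_distrl /=.
rewrite !big_seq; apply: eq_bigr => l lin.
rewrite big_distrr /= !big_seq; apply: eq_bigr => r rin.
rewrite (@distinct_startsS _ _ (m - p)).
- rewrite !exprD [in RHS]mulrC; congr (_ * (_ * _)); by case: (p == 0%N).
- by apply/(@mem_cycle_factors_list k); [lia|exact: rin].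
- by apply/(@mem_cycle_factors_list k); [lia|exact: lin].
Qed.

(* [ballot s h] is the coefficient of z^s in W(z)^h, where W = 1 + z W^2 + (X - 1) z W
   is the generating series of [starts_poly]. *)
Fixpoint ballot (s : nat) : nat -> {poly rat} :=
  if s is s'.+1 then
    fix ballot_s h := if h is h'.+1
      then ballot_s h' + ballot s' h'.+2 + ('X - 1) * ballot s' h'.+1 else 0
  else fun=> 1.

Arguments ballot : simpl never.

Lemma ballot0 h : ballot 0 h = 1. Proof. by []. Qed.

Lemma ballotSS s h :
  ballot s.+1 h.+1 = ballot s.+1 h + ballot s h.+2 + ('X - 1) * ballot s h.+1.
Proof. by []. Qed.

(** This is W^h W^g = W^(h+g), obtained from the recursion alone by induction on s, then on h. *)
Lemma ballot_convolution s h g :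
  \sum_(0 <= i < s.+1) ballot i h * ballot (s - i) g = ballot s (h + g).
Proof.
elim: s h g => [|s IHs] h g; first by rewrite big_nat1 mul1r.
elim: h => [|h IHh].
  rewrite big_nat_recl // mul1r subn0 big1_seq ?addr0 // => i _.
  by rewrite mul0r.
rewrite big_nat_recl // ballot0 mul1r addSn ballotSS -IHh.
rewrite [in RHS]big_nat_recl // ballot0 mul1r -!addrA.
congr (_ + _); under eq_bigr do rewrite ballotSS 2!mulrDl.
rewrite !big_split /= -!addrA; congr (_ + (_ + _)).
- by rewrite IHs !addSn.
- under eq_bigr do rewrite subSS -mulrA; by rewrite -big_distrr IHs addSn.
Qed.

Lemma starts_poly_ballot k i m : (m <= k)%N ->
  starts_poly (cycle_factors_list k i m) = ballot m 1.
Proof.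
elim: k i m => [|k IH] i [|m] // mk; rewrite ?[starts_poly _]big_seq1 //.
(* The recursion at h = 0 is the equation of W. After expanding W^2, its term p = 0 absorbs
   [('X - 1) * ballot m 1], which turns its factor 1 into ['X]. *)
rewrite starts_polyS // ballotSS add0r -[2%N]/(1 + 1)%N -ballot_convolution.
rewrite !(big_nat_recl m) //= addrAC; congr (_ + _).
  by rewrite subn0 !IH //=; ring.
rewrite !big_seq; apply: eq_bigr => p; rewrite mem_index_iota => pm.
by rewrite !IH ?mulr1 //; lia.
Qed.

Lemma coef_ballotSS s h k : (ballot s.+1 h.+1)`_k =
  (ballot s.+1 h)`_k + (ballot s h.+2)`_k +
  ((if k == 0%N then 0 else (ballot s h.+1)`_k.-1) - (ballot s h.+1)`_k).
Proof. by rewrite ballotSS 2!coefD mulrBl coefB coefXM mul1r. Qed.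

Lemma coef_ballot0 s h : (ballot s.+1 h)`_0 = 0.
Proof.
elim: s h => [|s IHs]; elim=> [|h IHh]; rewrite ?coef0 // coef_ballotSS IHh.
  by rewrite !ballot0 !coef1 /= add0r sub0r subrr.
by rewrite !IHs /= subr0 add0r.
Qed.

Lemma natr_bin_left (F : pzRingType) n k :
  k.+1%:R * 'C(n, k.+1)%:R = (n%:R - k%:R) * 'C(n, k)%:R :> F.
Proof.
have [kn|nk] := leqP k n; first by rewrite -natrB // -!natrM mul_bin_left.
by rewrite !bin_small ?mulr0 // ltnW.
Qed.

Lemma coef_ballot s h k :
  (ballot s.+1 h)`_k.+1 = h%:R / k.+1%:R * 'C(h + s, k)%:R * 'C(s, k)%:R.
Proof.
have nz n : (n.+1%:R : rat) != 0 by rewrite Num.Theory.pnatr_eq0.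
elim: s h k => [|s IHs]; elim=> [|h IHh] k; rewrite ?coef0 ?mul0r // coef_ballotSS IHh.
  rewrite !ballot0 !coef1 -natr1 bin0n addn0.
  case: k => [|k]; last by rewrite /=; ring.
  by rewrite !bin0 /=; field.
rewrite !IHs /=.
case: k => [|k]; first by rewrite !bin0 coef_ballot0 -!natr1; field.
rewrite IHs.
have -> : (h.+2 + s)%N = (h + s.+1).+1 by lia.
have -> : (h.+1 + s.+1)%N = (h + s.+1).+1 by lia.
have -> : (h.+1 + s)%N = (h + s.+1)%N by lia.
rewrite !binS !natrD.
(* Once all binomials are expressed through ['C(h + s.+1, k)] and ['C(s, k)], the recursion is an
   identity of rational functions. *)
have eA : 'C(h + s.+1, k.+1)%:R = ((h + s.+1)%:R - k%:R) / k.+1%:R * 'C(h + s.+1, k)%:R :> rat.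
  by rewrite mulrAC -natr_bin_left; field; rewrite addrC natr1 nz.
have eB : 'C(s, k.+1)%:R = (s%:R - k%:R) / k.+1%:R * 'C(s, k)%:R :> rat.
  by rewrite mulrAC -natr_bin_left; field; rewrite addrC natr1 nz.
rewrite eA eB natrD -!natr1; field.
by rewrite !natr1 !nz.
Qed.

(** The counts are the Narayana numbers; the factor [m.+1] clears their denominator. *)
Lemma count_distinct_starts m i k :
  (count (fun l => distinct_starts l == k.+1) (cycle_factors_list m.+1 i m.+1) * m.+1 =
  'C(m.+1, k.+1) * 'C(m.+1, k))%N.
Proof.
apply/eqP; rewrite -(@Num.Theory.eqr_nat rat) !natrM -coef_starts_poly.
rewrite (@starts_poly_ballot m.+1) // coef_ballot add1n mul1r.
have e : m.+1%:R * 'C(m, k)%:R = k.+1%:R * 'C(m.+1, k.+1)%:R :> rat.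
  by rewrite -!natrM; have := mul_bin_diag m.+1 k => /= ->.
have nz : k.+1%:R != 0 :> rat by rewrite Num.Theory.pnatr_eq0.
have -> : 'C(m.+1, k.+1)%:R = m.+1%:R * 'C(m, k)%:R / k.+1%:R :> rat.
  by rewrite e mulrAC mulfV ?mul1r.
by apply/eqP; ring.
Qed.

End Enumeration.

(** * Transpositions as pairs of labels *)

Section Bridge.

(** A general [Q] serves three purposes: a single value for the law, a half-line for the
    distribution function, everything for the total count. *)
Lemma count_distinct_starts_pred m i (Q : pred nat) :
  count (fun l => Q (distinct_starts l)) (cycle_factors_list m.+1 i m.+1) * m.+1 =
  \sum_(j < m.+1 | Q j.+1) 'C(m.+1, j.+1) * 'C(m.+1, j).
Proof.
set s := cycle_factors_list _ _ _.
have -> : count (fun l => Q (distinct_starts l)) s =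
    \sum_(j < m.+1 | Q j.+1) count (fun l => distinct_starts l == j.+1) s.
  rewrite -sum1_count; under [RHS]eq_bigr do rewrite -sum1_count big_mkcond.
  rewrite exchange_big /= big_mkcond big_seq [RHS]big_seq; apply: eq_bigr => l ls.
  have [l_in l_size _ _] : cycle_factors i m.+1 l by exact/mem_cycle_factors_list/ls.
  have ds : 0 < distinct_starts l <= m.+1.
    rewrite /distinct_starts -l_size -(size_map fst) size_undup andbT.
    case: l l_size {l_in ls} => // e l _.
    have : e.1 \in undup (unzip1 (e :: l)) by rewrite mem_undup mem_head.
    by case: (undup _).
  have dm : (distinct_starts l).-1 < m.+1 by lia.
  rewrite big_mkcond (bigD1 (Ordinal dm)) //= prednK ?eqxx ?big1 ?addn0 //; last by lia.
  move=> k /eqP km; case: (Q _) => //; case: eqP => // dk.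
  by case: km; apply: val_inj; rewrite /= dk.
rewrite big_distrl /=; apply: eq_bigr => j _; exact: count_distinct_starts.
Qed.

(** Vandermonde's identity sums the Narayana numbers to a Catalan number. *)
Lemma size_cycle_factors_list m i :
  size (cycle_factors_list m.+1 i m.+1) * m.+2 = 'C(2 * m.+1, m.+1).
Proof.
have e : size (cycle_factors_list m.+1 i m.+1) * m.+1 = 'C(2 * m.+1, m).
  rewrite -count_predT (@count_distinct_starts_pred m i xpredT).
  rewrite mul2n -addnn -binomial.Vandermonde; apply: eq_bigr => k _.
  by rewrite mulnC -(@bin_sub m.+1 k.+1) ?subSS.
apply/eqP; rewrite -(@eqn_pmul2r m.+1) // mulnAC e mulnC -[X in _ == X]mulnC mul_bin_left.
by apply/eqP; congr (_ * _); lia.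
Qed.

Variable m : nat.

Definition edge_of (s : {perm 'I_m.+1}) : nat * nat := (lo s, hi s).

Definition perm_of (e : nat * nat) : {perm 'I_m.+1} := tperm (inord e.1.-1) (inord e.2.-1).

Lemma transpositionP (s : {perm 'I_m.+1}) :
  reflect (exists a b : 'I_m.+1, a < b /\ s = tperm a b) (transposition s).
Proof.
apply: (iffP existsP) => [[a /existsP[b /andP[ab /eqP->]]]|[a [b [ab ->]]]].
  have [lt|lt|/val_inj eq] := ltngtP a b; last by rewrite eq eqxx in ab.
    by exists a, b.
  by exists b, a; rewrite tpermC.
by exists a; apply/existsP; exists b; rewrite eqxx andbT neq_ltn ab.
Qed.

Lemma edge_of_in s : transposition s -> edge_in 1 m (edge_of s).
Proof.
move=> /transpositionP[a [b [ab ->]]].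
rewrite /edge_in /= lo_tperm // hi_tperm // !ltnS ab /=; have := ltn_ord b; lia.
Qed.

Lemma edge_ofK s : transposition s -> perm_of (edge_of s) = s.
Proof.
move=> /transpositionP[a [b [ab ->]]].
by rewrite /perm_of /edge_of /= lo_tperm // hi_tperm //= !inord_val.
Qed.

Lemma perm_ofK e : edge_in 1 m e -> edge_of (perm_of e) = e.
Proof.
case: e => a b; rewrite /edge_in /= => ab; rewrite /edge_of /perm_of /=.
have lt : (inord a.-1 : 'I_m.+1) < (inord b.-1 : 'I_m.+1) by rewrite !inordK; lia.
by rewrite lo_tperm // hi_tperm // !inordK; try lia; congr (_, _); lia.
Qed.

Lemma perm_of_transposition e : edge_in 1 m e -> transposition (perm_of e).
Proof.
move=> ein; apply/transpositionP; exists (inord e.1.-1), (inord e.2.-1); split=> //.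
by move: ein; rewrite /edge_in => ein; rewrite !inordK; lia.
Qed.

Lemma swap_edge_of s (x : 'I_m.+1) : transposition s -> swap (edge_of s) x.+1 = (s x).+1.
Proof.
move=> /transpositionP[a [b [ab ->]]].
rewrite /swap /= lo_tperm // hi_tperm // !eqSS !val_eqE.
case: tpermP => [->|->|/eqP xa /eqP xb]; rewrite ?eqxx //.
  by case: eqP => [->|].
by rewrite (negPf xa) (negPf xb).
Qed.

Lemma run_edge_of (t : seq {perm 'I_m.+1}) (x : 'I_m.+1) : all (@transposition _) t ->
  run (map edge_of t) x.+1 = ((\prod_(s <- t) s)%g x).+1.
Proof.
elim: t x => [|s t IH] x /=; first by rewrite big_nil perm1.
by move=> /andP[st tt]; rewrite big_cons permM -IH // -swap_edge_of.
Qed.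

Lemma interval_cycle_long (x : 'I_m.+1) : interval_cycle 1 m x.+1 = (long_cycle m.+1 x).+1.
Proof.
rewrite permE /= /interval_cycle; have := ltn_ord x; have [xm _|xm ?] := ltnP x m.
  by rewrite ifT ?modn_small //; lia.
have -> : nat_of_ord x = m by lia.
by rewrite modnn ifF ?ifT //; lia.
Qed.

Lemma decreasing_factorization_edges (t : perm_tuple m.+1) :
  decreasing_factorization t -> cycle_factors 1 m (map edge_of t).
Proof.
move=> /andP[/andP[tt /eqP tc] ts]; split.
- by rewrite all_map; apply: sub_all tt => s /edge_of_in.
- by rewrite size_map size_tuple.
- by rewrite /unzip1 -map_comp.
- move=> x; have [xm|xm] := boolP (0 < x < m.+2).
    have xm' : x.-1 < m.+1 by lia.
    have -> : x = (Ordinal xm').+1 by rewrite /=; lia.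
    by rewrite run_edge_of // tc interval_cycle_long.
  rewrite run_fix; first by rewrite /interval_cycle ifF ?ifF //; lia.
  move=> e /mapP[s st ->]; have := edge_of_in (allP tt _ st).
  by rewrite /edge_in; lia.
Qed.

Lemma cycle_factors_perm l : cycle_factors 1 m l ->
  exists2 t : perm_tuple m.+1, decreasing_factorization t & map edge_of t = l.
Proof.
move=> [l_in l_size l_sorted l_run].
have sz : size (map perm_of l) == m by rewrite size_map l_size.
have tl : map edge_of (map perm_of l) = l.
  by rewrite -map_comp map_id_in // => e /(allP l_in)/perm_ofK.
exists (Tuple sz) => //.
have tt : all (@transposition _) (map perm_of l).
  by rewrite all_map; apply: sub_all l_in => e; exact: perm_of_transposition.
apply/andP; split; last first.
  by move: l_sorted; rewrite -{1}tl /unzip1 -map_comp.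
apply/andP; split=> //; apply/eqP/permP => x; apply: val_inj; apply: succn_inj.
by rewrite -run_edge_of //= tl l_run interval_cycle_long.
Qed.

Lemma card_decreasing_factorization (Q : pred (seq (nat * nat))) :
  #|[set t : perm_tuple m.+1 | decreasing_factorization t && Q (map edge_of t)]%SET| =
  count Q (cycle_factors_list m 1 m).
Proof.
pose s := [seq map edge_of (t : perm_tuple m.+1)
  | t in [set t : perm_tuple m.+1 | decreasing_factorization t]%SET].
have ps : perm_eq s (cycle_factors_list m 1 m).
  apply: uniq_perm; [|exact: cycle_factors_list_uniq|].
    rewrite map_inj_in_uniq ?enum_uniq // => t u.
    rewrite !mem_enum !inE => /andP[/andP[tt _] _] /andP[/andP[ut _] _] tu.
    apply: val_inj; have eK (v : seq {perm 'I_m.+1}) : all (@transposition _) v ->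
      map perm_of (map edge_of v) = v.
      by move=> vt; rewrite -map_comp map_id_in // => x
        /(allP vt)/edge_ofK.
    by rewrite -[LHS]eK // tu eK.
  move=> l; apply/mapP/idP.
    move=> [t]; rewrite mem_enum inE => /decreasing_factorization_edges td ->.
    exact/mem_cycle_factors_list.
  move=> /mem_cycle_factors_list -/(_ (leqnn _))/cycle_factors_perm[t td <-].
  by exists t => //; rewrite mem_enum inE.
rewrite -(seq.permP ps) count_map -sum1_card -sum1_count big_filter_cond /=.
by apply: eq_bigl => t; rewrite !inE.
Qed.

End Bridge.

Lemma card_nb_a_values m (Q : pred nat) :
  #|[set t : perm_tuple m.+2 | decreasing_factorization t && Q (nb_a_values t)]%SET| * m.+1 =
  \sum_(j < m.+1 | Q j.+1) 'C(m.+1, j.+1) * 'C(m.+1, j).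
Proof.
rewrite -(count_distinct_starts_pred m 1) -card_decreasing_factorization.
congr (_ * _); apply: eq_card => t; rewrite !inE.
by rewrite /distinct_starts /unzip1 -map_comp.
Qed.

Lemma card_decreasing m :
  #|[set t | @decreasing_factorization m.+2 t]%SET| * m.+2 = 'C(2 * m.+1, m.+1).
Proof.
rewrite -(size_cycle_factors_list m 1) -count_predT -card_decreasing_factorization.
by congr (_ * _); apply: eq_card => t; rewrite !inE andbT.
Qed.

Import Order.TTheory GRing.Theory Num.Theory.
Import numFieldNormedType.Exports.

Local Open Scope classical_set_scope.
Local Open Scope ring_scope.

(** * Exact law *)

Section UniformFactorization.
Context (R : realType) (d : measure_display) (T : measurableType d) (P : probability T R).

Lemma prob_uniform n (tau : {RV P >-> perm_tuple n}) (Q : pred (perm_tuple n)) :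
  uniform_decreasing_factorization tau ->
  P [set w | Q (tau w)] =
    (#|[set t | decreasing_factorization t && Q t]%SET|%:R /
     #|[set t | @decreasing_factorization n t]%SET|%:R)%:E.
Proof.
move=> unif; transitivity (distribution P tau [set t | Q t]); first by [].
(* Uniformity gives only the masses of single tuples, so the event is cut into singletons. *)
have -> : [set t | Q t] = \bigcup_(t in [set` Q]) [set t].
  by apply/seteqP; split=> [t Qt|t [u Qu ->]] //; exists t.
rewrite measure_fin_bigcup //; last first.
  by move=> t u _ _ [x [-> ->]].
rewrite -(@bigfs _ _ _ _ (index_enum (perm_tuple n)) Q) ?index_enum_uniq //; last first.
  by move=> t _; rewrite mem_index_enum.
rewrite (eq_bigr _ (fun t _ => unif t)) sumEFin -big_mkcondr /=.
set c := (_ : R)^-1; rewrite -sum1_card natr_sum mulr_suml.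
congr EFin; apply: eq_big => [t|t _]; first by rewrite inE andbC.
by rewrite mul1r.
Qed.

Context (n : nat) (tau : {RV P >-> perm_tuple n}).
Hypothesis n_gt1 : (2 <= n)%N.
Hypothesis tau_unif : uniform_decreasing_factorization tau.

Let nE : n = n.-2.+2. Proof. by lia. Qed.

(** Without any decreasing factorisation, uniformity would make the total mass 0 instead of 1. *)
Lemma card_decreasing_gt0 : (0 < #|[set t | @decreasing_factorization n t]%SET|)%N.
Proof.
rewrite lt0n; apply/eqP => card0; have := prob_uniform xpredT tau_unif.
rewrite card0 invr0 mulr0 (_ : [set w | _] = setT) ?probability_setT; last exact/seteqP.
by move=> /eqP; rewrite onee_eq0.
Qed.

Lemma ae_b_values :
  {ae P, forall w, b_values (tau w) =i [pred b | (2 <= b <= n)%N]}.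
Proof.
exists [set w | ~~ decreasing_factorization (tau w)]; split.
- have := @measurable_funPT _ _ _ _ tau measurableT.
  by move/(_ [set t | ~~ decreasing_factorization t] I); rewrite setTI.
- rewrite (prob_uniform (fun t => ~~ decreasing_factorization t) tau_unif).
  by under eq_finset do rewrite andbN; rewrite cards0 mul0r.
move=> w /= bw; apply/negP => tw; apply: bw.
move: (tau w) tw; rewrite nE => t /decreasing_factorization_edges.
move=> /mem_unzip2_cycle_factors; rewrite /unzip2 -map_comp => bt b.
by rewrite [LHS]bt !inE; lia.
Qed.

Lemma prob_nb_a_values (Q : pred nat) :
  P [set w | Q (nb_a_values (tau w))] =
    ((\sum_(j < n.-1 | Q j.+1) ('C(n.-1, j.+1) * 'C(n.-1, j))%:R) /
     (n.-1%:R * #|[set t | @decreasing_factorization n t]%SET|%:R))%:E.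
Proof.
rewrite (prob_uniform (fun t => Q (nb_a_values t)) tau_unif); congr EFin.
move: (n) n_gt1 => [//|[//|m]] _.
by rewrite -natr_sum /= -card_nb_a_values natrM invfM mulrA mulfK.
Qed.

(** The normalisation is the Catalan number of index n-1, namely ['C(2 * n.-1, n.-1)] divided by n.
    The index n, that is (n+1) / C(2n,n), would give 1/2 instead of 1 for n = 2, k = 1. *)
Lemma prob_nb_a_values_eq (k : nat) : (1 <= k <= n.-1)%N ->
  P [set w | nb_a_values (tau w) = k] =
    (n%:R / n.-1%:R * 'C(n.-1, k)%:R * 'C(n.-1, k.-1)%:R
      / 'C(2 * n.-1, n.-1)%:R)%:E.
Proof.
case: k => // k /= kn.
rewrite (_ : [set w | _] = [set w | pred1 k.+1 (nb_a_values (tau w))]); last first.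
  by apply/seteqP; split=> w /= => [->|/eqP].
rewrite prob_nb_a_values (big_pred1 (Ordinal kn)) //=; congr EFin.
have := card_decreasing_gt0.
move: (n) n_gt1 kn => [//|[//|m]] _ kn; set c := #|_| => c0.
rewrite -card_decreasing -/c !natrM.
have nz j : j.+1%:R != 0 :> R by rewrite pnatr_eq0.
have cz : c%:R != 0 :> R by rewrite pnatr_eq0 -lt0n.
by field; rewrite cz -natrD !nz.
Qed.

(** As a quotient of sums of unnormalised weights, the probability can be studied up to a common
    scaling. *)
Lemma prob_nb_a_values_ratio (Q : pred nat) :
  P [set w | Q (nb_a_values (tau w))] =
    ((\sum_(j < n.-1 | Q j.+1) ('C(n.-1, j.+1) * 'C(n.-1, j))%:R) /
     (\sum_(j < n.-1) ('C(n.-1, j.+1) * 'C(n.-1, j))%:R))%:E.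
Proof.
rewrite prob_nb_a_values; congr (_ / _)%:E.
move: (n) n_gt1 => [//|[//|m]] _.
rewrite -natr_sum /= -(card_nb_a_values m xpredT) mulnC natrM; congr (_ * _%:R).
by apply: eq_card => t; rewrite !inE andbT.
Qed.

End UniformFactorization.

(** * Gaussian bounds on the weights *)

Section LocalLimit.
Variable R : realType.
Implicit Types (N j : nat) (d x y : R).

Definition weight N j : R := ('C(N, j.+1) * 'C(N, j))%:R.

(* With n = N + 1 and k = j + 1, this is k - n/2. *)
Definition deviation N j : R := j%:R - (N%:R - 1) / 2.

Lemma deviationS N j : deviation N j.+1 = deviation N j + 1.
Proof. by rewrite /deviation -natr1; ring. Qed.

Lemma weight_gt0 N j : (j < N)%N -> 0 < weight N j.
Proof. by move=> jN; rewrite ltr0n muln_gt0 !bin_gt0 jN ltnW. Qed.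

(** Here [d] is the deviation of the midpoint between j and j+1; centring there makes the two
    coefficients mirror images under d -> -d. *)
Lemma weightS N j (h := N%:R / 2) (d := deviation N j + 2^-1) :
  (h + d) * (h + 1 + d) * weight N j.+1 = (h - d) * (h + 1 - d) * weight N j.
Proof.
have -> : h + d = j.+1%:R by rewrite /d /h /deviation -natr1; field.
have -> : h + 1 + d = j.+2%:R by rewrite /d /h /deviation -!natr1; field.
have -> : h - d = N%:R - j.+1%:R by rewrite /d /h /deviation -natr1; field.
have -> : h + 1 - d = N%:R - j%:R by rewrite /d /h /deviation; field.
rewrite /weight !natrM mulrACA [_ * 'C(N, j.+2)%:R]mulrC.
have := natr_bin_left R N j; have := natr_bin_left R N j.+1.
set a := 'C(N, j)%:R; set b := 'C(N, j.+1)%:R; set c := 'C(N, j.+2)%:R => e1 e2.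
transitivity ((j.+2%:R * c) * (j.+1%:R * b)); first by ring.
by rewrite e1 e2; ring.
Qed.

(** This is 1 + z <= exp z at z = -2d/y. The bound [y] replaces [x] in the exponent so that
    successive quotients can share one denominator. *)
Lemma expR_contraction_le d x y : 0 <= d -> 0 < x -> x <= y ->
  x - 2 * d <= x * expR (- (2 * d / y)).
Proof.
move=> d0 x0 xy; have y0 := lt_le_trans x0 xy.
apply: (@le_trans _ _ (x * (1 + - (2 * d / y)))); last first.
  by rewrite ler_pM2l // expR_ge1Dx.
rewrite mulrDr mulr1 lerD2l mulrN lerN2 mulrA ler_pdivrMr //.
by rewrite mulrC ler_wpM2l // mulr_ge0.
Qed.

Lemma expR_contraction_ge d x y : 0 <= d -> 0 < y -> y <= x ->
  (x + 2 * d) * expR (- (2 * d / y)) <= x.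
Proof.
move=> d0 y0 yx; have x0 := lt_le_trans y0 yx.
rewrite expRN ler_pdivrMr ?expR_gt0 //.
apply: (@le_trans _ _ (x * (1 + 2 * d / y))); last first.
  by rewrite ler_pM2l // expR_ge1Dx.
rewrite mulrDr mulr1 lerD2l mulrA ler_pdivlMr //.
by rewrite mulrC ler_wpM2r // mulr_ge0.
Qed.

(** The central index has deviation 0 for odd N and 1/2 for even N, hence the subtracted squares in
    the bounds on the weights. *)
Lemma deviation_half N : 0 <= deviation N N./2 <= 2^-1.
Proof.
have -> : deviation N N./2 = (1 - (odd N)%:R) / 2.
  by rewrite /deviation -{2}(odd_double_half N) natrD -muln2 natrM; field.
by case: odd; rewrite /=; lra.
Qed.

Lemma deviation_ge_half N j : (N./2 <= j)%N -> deviation N N./2 <= deviation N j.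
Proof. by move=> Nj; rewrite lerD2r ler_nat. Qed.

(** Induction outwards from the centre. With [y] fixed throughout, all quotients of consecutive
    weights are bounded with the same denominator, and the exponents telescope. *)
Lemma weight_le_half N j y : (N./2 <= j < N)%N -> deviation N j <= y ->
  weight N j <= weight N N./2 *
    expR (- (2 * (deviation N j ^+ 2 - deviation N N./2 ^+ 2) / (N%:R / 2 + 1 + y))).
Proof.
move=> /andP[]; elim: j => [|j IH].
  rewrite leqn0 => /eqP -> _ _.
  by rewrite subrr mulr0 mul0r oppr0 expR0 mulr1.
rewrite leq_eqVlt => /orP[/eqP <- _ _|].
  by rewrite subrr mulr0 mul0r oppr0 expR0 mulr1.
rewrite ltnS => Nj jN uy; rewrite deviationS in uy *.
have /andP[u0 _] := deviation_half N.
have := deviation_ge_half Nj; set u := deviation N j in uy IH * => uu.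
have {}IH := IH Nj (ltnW jN) ltac:(lra).
set M := _ + y in IH *; pose d := u + 2^-1; pose h : R := N%:R / 2.
have d0 : 0 <= d by rewrite /d; lra.
have hN : 0 <= h by rewrite /h divr_ge0.
have dh : d < h.
  have : j.+2%:R <= N%:R :> R by rewrite ler_nat.
  by rewrite /d /h /u /deviation -[j.+2%:R]natr1 -[j.+1%:R]natr1 => hj; lra.
have hd : 0 < h + d by lra.
have h1 : h - d <= (h + d) * expR (- (2 * d / M)).
  rewrite (_ : h - d = h + d - 2 * d); last by ring.
  by apply: expR_contraction_le => //; rewrite /M /d -/h; lra.
have h2 : h + 1 - d <= (h + 1 + d) * expR (- (2 * d / M)).
  rewrite (_ : h + 1 - d = h + 1 + d - 2 * d); last by ring.
  by apply: expR_contraction_le => //; rewrite /M /d -/h; lra.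
have M0 : M != 0 by rewrite gt_eqF // /M -/h; lra.
(* Telescoping: (u+1)^2 - u^2 = 2d, and each of the two factors in the quotient contributes 2d/M. *)
have -> : - (2 * ((u + 1) ^+ 2 - deviation N N./2 ^+ 2) / M) =
    - (2 * d / M) + - (2 * d / M) + - (2 * (u ^+ 2 - deviation N N./2 ^+ 2) / M).
  by rewrite /d; field.
rewrite !expRD; set E := expR (- (2 * d / M)) in h1 h2 *.
have hh : 0 < (h + d) * (h + 1 + d) by rewrite mulr_gt0 //; lra.
rewrite -(ler_pM2l hh) weightS -/h -/d.
apply: (@le_trans _ _ ((h + d) * E * ((h + 1 + d) * E) * weight N j)).
  apply: ler_wpM2r; first exact: ler0n.
  by apply: ler_pM => //; lra.
rewrite [X in _ <= X](_ : _ = (h + d) * E * ((h + 1 + d) * E) *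
  (weight N N./2 * expR (- (2 * (u ^+ 2 - deviation N N./2 ^+ 2) / M)))); last by ring.
by rewrite ler_wpM2l // ?mulr_ge0 ?expR_ge0 //; lra.
Qed.

(** Same induction, with N/2 - y as a common lower bound for the factors h - d and h + 1 - d;
    [y < N%:R / 2] keeps it positive. *)
Lemma weight_ge_half N j y : (N./2 <= j < N)%N -> deviation N j <= y -> y < N%:R / 2 ->
  weight N N./2 *
    expR (- (2 * (deviation N j ^+ 2 - deviation N N./2 ^+ 2) / (N%:R / 2 - y)))
  <= weight N j.
Proof.
move=> /andP[] + + + yN; elim: j => [|j IH].
  rewrite leqn0 => /eqP -> _ _.
  by rewrite subrr mulr0 mul0r oppr0 expR0 mulr1.
rewrite leq_eqVlt => /orP[/eqP <- _ _|].
  by rewrite subrr mulr0 mul0r oppr0 expR0 mulr1.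
rewrite ltnS => Nj jN uy; rewrite deviationS in uy *.
have /andP[u0 _] := deviation_half N.
have := deviation_ge_half Nj; set u := deviation N j in uy IH * => uu.
have {}IH := IH Nj (ltnW jN) ltac:(lra).
set M := _ - y in IH *; pose d := u + 2^-1; pose h : R := N%:R / 2.
have d0 : 0 <= d by rewrite /d; lra.
have M0 : 0 < M by rewrite /M subr_gt0.
have M1 : M != 0 by rewrite gt_eqF.
have dM : M <= h - d by rewrite /M /d -/h; lra.
have h1 : (h + d) * expR (- (2 * d / M)) <= h - d.
  by rewrite (_ : h + d = h - d + 2 * d); [exact: expR_contraction_ge|ring].
have h2 : (h + 1 + d) * expR (- (2 * d / M)) <= h + 1 - d.
  by rewrite (_ : h + 1 + d = h + 1 - d + 2 * d); [apply: expR_contraction_ge => //; lra|ring].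
have -> : - (2 * ((u + 1) ^+ 2 - deviation N N./2 ^+ 2) / M) =
    - (2 * d / M) + - (2 * d / M) + - (2 * (u ^+ 2 - deviation N N./2 ^+ 2) / M).
  by rewrite /d; field.
rewrite !expRD; set E := expR (- (2 * d / M)) in h1 h2 *.
have E0 : 0 < E by exact: expR_gt0.
have hh : 0 < (h + d) * (h + 1 + d) by rewrite mulr_gt0 //; lra.
rewrite -(ler_pM2l hh) weightS -/h -/d.
apply: (@le_trans _ _ ((h + d) * E * ((h + 1 + d) * E) * weight N j)); last first.
  apply: ler_wpM2r; first exact: ler0n.
  by apply: ler_pM => //; rewrite mulr_ge0 ?(ltW E0) //; lra.
rewrite [leLHS](_ : _ = (h + d) * E * ((h + 1 + d) * E) *
  (weight N N./2 * expR (- (2 * (u ^+ 2 - deviation N N./2 ^+ 2) / M)))); last by ring.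
by rewrite ler_wpM2l // ?mulr_ge0 ?(ltW E0) //; lra.
Qed.

Lemma weight_rev N j : (j < N)%N -> weight N (N - j.+1) = weight N j.
Proof.
move=> jN; rewrite /weight mulnC; congr (_ * _)%:R; last first.
  by rewrite -subSn // subSS bin_sub // ltnW.
by rewrite bin_sub.
Qed.

Lemma deviation_rev N j : (j < N)%N -> deviation N (N - j.+1) = - deviation N j.
Proof. by move=> jN; rewrite /deviation natrB // -[j.+1%:R]natr1; field. Qed.

Lemma norm_deviation_lt N j : (j < N)%N -> `|deviation N j| < N%:R / 2.
Proof.
move=> jN; have : j.+1%:R <= N%:R :> R by rewrite ler_nat.
have : 0 <= j%:R :> R by [].
by rewrite -[j.+1%:R]natr1 ltr_norml /deviation => ? ?; apply/andP; split; lra.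
Qed.

(** The reflection j -> N-1-j preserves weights and negates deviations, so bounds on the upper half
    cover every j. *)
Lemma half_rev N j : (j < N)%N -> (N./2 <= j)%N || (N./2 <= N - j.+1)%N.
Proof. by move=> jN; lia. Qed.

Lemma weight_le N j : (j < N)%N ->
  weight N j <= weight N N./2 * expR (- (2 * (deviation N j ^+ 2 - deviation N N./2 ^+ 2) /
    (N%:R / 2 + 1 + `|deviation N j|))).
Proof.
move=> jN; have /orP[Nj|Nj] := half_rev jN.
  by apply: weight_le_half; rewrite ?Nj // ler_norm.
rewrite -(weight_rev jN) -sqrrN -(deviation_rev jN).
apply: weight_le_half; first by rewrite Nj; lia.
by rewrite deviation_rev // ler_normr lexx orbT.
Qed.

Lemma weight_ge N j : (j < N)%N ->
  weight N N./2 * expR (- (2 * (deviation N j ^+ 2 - deviation N N./2 ^+ 2) /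
    (N%:R / 2 - `|deviation N j|))) <= weight N j.
Proof.
move=> jN; have uN := norm_deviation_lt jN; have /orP[Nj|Nj] := half_rev jN.
  by apply: weight_ge_half; rewrite ?Nj // ler_norm.
rewrite -(weight_rev jN) -sqrrN -(deviation_rev jN).
apply: weight_ge_half => //; first by rewrite Nj; lia.
by rewrite deviation_rev // ler_normr lexx orbT.
Qed.

End LocalLimit.

(** * Convergence of the step functions *)

Section StepFunctions.
Variable R : realType.
Implicit Types (N j : nat) (t : R) (Q : pred R).

Local Notation mesh N := ((Num.sqrt (N.+1%:R : R))^-1).

Definition grid N j : R := deviation R N j * mesh N.

(** Dividing by the central weight avoids its asymptotics: it cancels in the final quotient. *)
Definition rel_weight N j : R := weight R N j / weight R N N./2.

(* [Q] selects cells by their left end point: taking [Q s := s <= x] makes the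
   integral over the whole line a partial sum of weights. *)
Definition step N Q t : R :=
  \sum_(j < N | Q (grid N j)) rel_weight N j * \1_(`[grid N j, grid N j.+1[) t.

Lemma mesh_gt0 N : 0 < mesh N.
Proof. by rewrite invr_gt0 sqrtr_gt0. Qed.

Lemma mesh_le1 N : mesh N <= 1.
Proof. by rewrite invf_le1 ?sqrtr_gt0 // -[leLHS]sqrtr1 ler_wsqrtr // ler1n. Qed.

Lemma sqr_mesh N : mesh N ^+ 2 = N.+1%:R^-1.
Proof. by rewrite exprVn sqr_sqrtr. Qed.

Lemma gridS N j : grid N j.+1 = grid N j + mesh N.
Proof. by rewrite /grid deviationS mulrDl mul1r. Qed.

Lemma grid_le N i j : (i <= j)%N -> grid N i <= grid N j.
Proof.
by move=> ij; rewrite ler_pM2r ?mesh_gt0 // lerD2r ler_nat.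
Qed.

Lemma rel_weight_ge0 N j : 0 <= rel_weight N j.
Proof. by rewrite divr_ge0. Qed.

Lemma step_ge0 N Q t : 0 <= step N Q t.
Proof.
by apply: sumr_ge0 => j _; rewrite mulr_ge0 ?rel_weight_ge0 // indicE.
Qed.

Lemma step_cell N Q t j : (j < N)%N -> grid N j <= t < grid N j.+1 ->
  step N Q t = if Q (grid N j) then rel_weight N j else 0.
Proof.
move=> jN tj; rewrite /step big_mkcond (bigD1 (Ordinal jN)) //= big1 ?addr0.
  by rewrite indicE mem_set ?mulr1 //= in_itv.
move=> i /eqP ij; case: ifP => // _; rewrite indicE memNset ?mulr0 //= in_itv /= => ti.
case: ij; apply: val_inj => /=; have [ij|ji|//] := ltngtP i j.
  have /andP[_ t1] := ti; have /andP[t2 _] := tj.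
  by have := le_lt_trans (le_trans (grid_le N ij) t2) t1; rewrite ltxx.
have /andP[_ t1] := tj; have /andP[t2 _] := ti.
by have := le_lt_trans (le_trans (grid_le N ji) t2) t1; rewrite ltxx.
Qed.

Lemma step_out N Q t : (forall j, (j < N)%N -> ~ (grid N j <= t < grid N j.+1)) ->
  step N Q t = 0.
Proof.
move=> out; rewrite /step big1 // => j _.
by rewrite indicE memNset ?mulr0 //= in_itv /=; exact: out.
Qed.

Lemma deviation_half_le N j : (j < N)%N ->
  deviation R N N./2 ^+ 2 <= deviation R N j ^+ 2.
Proof.
move=> jN; have /andP[u0 _] := deviation_half R N.
have /orP[/(deviation_ge_half R) uj|/(deviation_ge_half R)] := half_rev jN.
  by rewrite ler_pXn2r ?nnegrE // (le_trans u0 uj).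
rewrite deviation_rev // => uj.
by rewrite -[leRHS]sqrrN ler_pXn2r ?nnegrE // (le_trans u0 uj).
Qed.

Lemma sqr_deviation_half N : deviation R N N./2 ^+ 2 <= 4^-1.
Proof.
have /andP[u0 u1] := deviation_half R N.
have -> : 4^-1 = 2^-1 ^+ 2 :> R by field.
by rewrite ler_pXn2r ?nnegrE // invr_ge0.
Qed.

Lemma rel_weight_le N j : (j < N)%N ->
  rel_weight N j <= expR (- (2 * (deviation R N j ^+ 2 - deviation R N N./2 ^+ 2) /
    (N%:R / 2 + 1 + `|deviation R N j|))).
Proof.
move=> jN; have hN : (N./2 < N)%N by lia.
by rewrite ler_pdivrMr ?weight_gt0 // mulrC weight_le.
Qed.

Lemma rel_weight_ge N j : (j < N)%N ->
  expR (- (2 * (deviation R N j ^+ 2 - deviation R N N./2 ^+ 2) /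
    (N%:R / 2 - `|deviation R N j|))) <= rel_weight N j.
Proof.
move=> jN; have hN : (N./2 < N)%N by lia.
by rewrite ler_pdivlMr ?weight_gt0 // mulrC weight_ge.
Qed.

Lemma step_le N Q t : step N Q t <= expR (5 / 2) * expR (- t ^+ 2).
Proof.
have C0 : 0 <= expR (5 / 2) * expR (- t ^+ 2) by rewrite mulr_ge0 ?expR_ge0.
have [[j [jN tj]]|out] := pselect (exists j, (j < N)%N /\ grid N j <= t < grid N j.+1); last first.
  by rewrite step_out // => j jN tj; apply: out; exists j.
rewrite (step_cell _ jN tj); case: ifP => // _.
apply: le_trans (rel_weight_le jN) _; rewrite -expRD ler_expR.
have uN := norm_deviation_lt R jN; have u0 := deviation_half_le jN.
set u := deviation R N j in uN u0 *.
have n0 : 0 < N.+1%:R :> R by [].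
have h0 : 0 <= N%:R / 2 :> R by rewrite divr_ge0.
have Mn : N%:R / 2 + 1 + `|u| <= N.+1%:R by rewrite -[N.+1%:R]natr1; lra.
have M0 : 0 < N%:R / 2 + 1 + `|u| by have := normr_ge0 u; lra.
set D := u ^+ 2 - _; have D0 : 0 <= D by rewrite subr_ge0.
apply: (@le_trans _ _ (- (2 * D / N.+1%:R))).
  by rewrite lerN2 ler_wpM2l ?mulr_ge0 // lef_pV2 ?posrE.
have uE : u ^+ 2 / N.+1%:R = grid N j ^+ 2.
  by rewrite /grid exprMn sqr_mesh.
have D1 : u ^+ 2 / N.+1%:R - 4^-1 <= D / N.+1%:R.
  rewrite /D mulrBl lerD2l lerN2 ler_pdivrMr //.
  apply: le_trans (sqr_deviation_half N) _.
  by rewrite ler_peMr ?invr_ge0 // ler1n.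
rewrite -mulrA; move: D1; rewrite uE; set a := grid N j in tj *.
have := mesh_le1 N; move: tj; rewrite gridS -/a.
move=> /andP[t1 t2] m1 D1.
(* Origin of 5/2: the exponent is at most -2a^2 + 1/2, and t^2 = 2a^2 + 2(t-a)^2 - (2a-t)^2 <= 2a^2
   + 2. *)
have s0 : 0 <= (2 * a - t) ^+ 2 by exact: sqr_ge0.
have s1 : (t - a) ^+ 2 <= 1 by rewrite expr_le1 //; lra.
rewrite !expr2 in s0 s1 D1 *; set q := D / _ in D1 *.
by clearbody q; clear -s0 s1 D1; nra.
Qed.

End StepFunctions.

Section PointwiseLimit.
Variable R : realType.

Local Notation mesh N := ((Num.sqrt (N.+1%:R : R))^-1).

Lemma cvg_mesh : (fun N : nat => mesh N) @ \oo --> (0 : R).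
Proof.
have -> : (fun N : nat => mesh N) = Num.sqrt \o (@harmonic R).
  by apply/funext => N /=; rewrite sqrtrV.
rewrite -[X in _ --> X](@sqrtr0 R); apply: continuous_cvg; last exact: cvg_harmonic.
exact: sqrt_continuous.
Qed.

Variable t : R.

(** The inequality [grid R N j <= t] solved for the largest j; for large N the truncated number is
    nonnegative. *)
Let cell N : nat := Num.truncn (t * Num.sqrt N.+1%:R + (N%:R - 1) / 2).

Let a N : R := grid R N (cell N).

Lemma near_cell : \forall N \near \oo,
  (cell N < N)%N /\ grid R N (cell N) <= t < grid R N (cell N).+1.
Proof.
near=> N.
have rt : 2 * `|t| + 2 <= Num.sqrt (N.+1%:R : R).
  rewrite -[leLHS]ger0_norm ?addr_ge0 // -sqrtr_sqr ler_wsqrtr //.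
  rewrite -[N.+1%:R]natr1 ler_wpDr //; near: N; exact: nbhs_infty_ger.
set r := Num.sqrt _ in rt; have r0 : 0 < r by rewrite sqrtr_gt0.
have rr : N%:R + 1 = r * r by rewrite natr1 -expr2 sqr_sqrtr.
have /andP[t1 t2] : - `|t| <= t <= `|t| by rewrite -ler_norml.
have tr1 : t * r <= `|t| * r by rewrite ler_pM2r.
have tr2 : - `|t| * r <= t * r by rewrite ler_pM2r.
have tr : `|t| * r <= (r - 2) / 2 * r by rewrite ler_pM2r //; lra.
have r2 : 2 <= r by have := normr_ge0 t; lra.
have y0 : 0 <= t * r + (N%:R - 1) / 2 by lra.
have /andP[c1 c2] := truncn_itv y0.
rewrite -/r -/(cell N) in c1 c2.
have cN : (cell N < N)%N by rewrite -(ltr_nat R); apply: le_lt_trans c1 _; lra.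
split=> //; rewrite /grid /deviation -/r ler_pdivrMr // ltr_pdivlMr //.
by apply/andP; split; lra.
Unshelve. all: by end_near. Qed.

Lemma cvg_grid_cell : a @ \oo --> t.
Proof.
apply: (@squeeze_cvgr _ _ _ _ (fun N => t - mesh N) (cst t)).
- near=> N; have [_ ] : (cell N < N)%N /\ grid R N (cell N) <= t < grid R N (cell N).+1.
    by near: N; exact: near_cell.
  by rewrite gridS -/(a N) /= => h; apply/andP; split; lra.
- rewrite -[X in _ --> X]subr0; apply: cvgB; [exact: cvg_cst|exact: cvg_mesh].
- exact: cvg_cst.
Unshelve. all: by end_near. Qed.

Let b N : R := deviation R N N./2 ^+ 2 * mesh N ^+ 2.

Lemma cvg_b : b @ \oo --> (0 : R).
Proof.
have e2 : (fun N => mesh N ^+ 2) @ \oo --> (0 : R).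
  by rewrite -[X in _ --> X](mul0r (0 : R)); apply: cvgM; exact: cvg_mesh.
apply: (@squeeze_cvgr _ _ _ _ (cst 0) (fun N => mesh N ^+ 2)); [|exact: cvg_cst|exact: e2].
near=> N; rewrite /b /= mulr_ge0 ?sqr_ge0 //= ler_piMl ?sqr_ge0 //.
by apply: le_trans (sqr_deviation_half R N) _; lra.
Unshelve. all: by end_near. Qed.

(** Multiplying both parts of the fraction by the squared mesh makes every term converge. The upper
    bound is the case s = c = 1, the lower bound s = -1, c = 0. *)
Lemma exponent_rescale N (s c : R) :
  2 * (deviation R N (cell N) ^+ 2 - deviation R N N./2 ^+ 2) /
    (N%:R / 2 + c + s * `|deviation R N (cell N)|) =
  2 * (a N ^+ 2 - b N) /
    ((1 - mesh N ^+ 2) / 2 + c * mesh N ^+ 2 + s * (`|a N| * mesh N)).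
Proof.
have m0 := mesh_gt0 R N; set e : R := mesh N in m0 *.
have e0 : e ^+ 2 != 0 by rewrite expf_neq0 // gt_eqF.
set u := deviation R N (cell N).
have aE : a N = u * e by [].
have Ne : N%:R * e ^+ 2 = 1 - e ^+ 2.
  have : N.+1%:R * e ^+ 2 = 1 by rewrite sqr_mesh mulfV.
  by rewrite -[N.+1%:R]natr1 mulrDl mul1r => h; apply: (addIr (e ^+ 2)); rewrite h subrK.
have scale (x y : R) : x / y = (x * e ^+ 2) / (y * e ^+ 2).
  by rewrite invfM mulrACA mulfV // mulr1.
rewrite [LHS]scale; congr (_ / _).
  by rewrite aE /b -/e; ring.
by rewrite aE normrM (ger0_norm (ltW m0)) -Ne; ring.
Qed.

Lemma cvg_exponent (s c : R) :
  (fun N => - (2 * (a N ^+ 2 - b N) /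
    ((1 - mesh N ^+ 2) / 2 + c * mesh N ^+ 2 + s * (`|a N| * mesh N)))) @ \oo -->
  - (4 * t ^+ 2).
Proof.
have e2 : (fun N => mesh N ^+ 2) @ \oo --> (0 : R).
  by rewrite -[X in _ --> X](mul0r (0 : R)); apply: cvgM; exact: cvg_mesh.
have -> : - (4 * t ^+ 2) =
    - (2 * (t ^+ 2 - 0) / ((1 - 0) / 2 + c * 0 + s * (`|t| * 0))) by field.
apply: cvgN; apply: cvgM.
  apply: cvgM; first exact: cvg_cst.
  by apply: cvgB; [apply: cvgM; exact: cvg_grid_cell|exact: cvg_b].
apply: cvgV; first by rewrite !mulr0 !addr0 subr0 mul1r invr_neq0.
apply: cvgD.
  apply: cvgD; last by apply: cvgM => //; exact: cvg_cst.
  apply: cvgM; last exact: cvg_cst.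
  by apply: cvgB => //; exact: cvg_cst.
apply: cvgM; first exact: cvg_cst.
by apply: cvgM; [apply: cvg_norm; exact: cvg_grid_cell|exact: cvg_mesh].
Qed.

Lemma cvg_rel_weight : (fun N => rel_weight R N (cell N)) @ \oo --> expR (- (4 * t ^+ 2)).
Proof.
apply: (@squeeze_cvgr _ _ _ _
  (fun N => expR (- (2 * (a N ^+ 2 - b N) /
    ((1 - mesh N ^+ 2) / 2 + 0 * mesh N ^+ 2 + (-1) * (`|a N| * mesh N)))))
  (fun N => expR (- (2 * (a N ^+ 2 - b N) /
    ((1 - mesh N ^+ 2) / 2 + 1 * mesh N ^+ 2 + 1 * (`|a N| * mesh N)))))).
- near=> N; have [cN _] : (cell N < N)%N /\ grid R N (cell N) <= t < grid R N (cell N).+1.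
    by near: N; exact: near_cell.
  rewrite -!exponent_rescale addr0 mulN1r mul1r.
  by rewrite rel_weight_le // rel_weight_ge.
- by apply: continuous_cvg; [exact: continuous_expR|exact: cvg_exponent].
- by apply: continuous_cvg; [exact: continuous_expR|exact: cvg_exponent].
Unshelve. all: by end_near. Qed.

(** The left end of the cell containing t tends to t from below, so the case t = x is no exception.
    The value [x = +oo] is allowed in order to treat the total mass too. *)
Lemma cvg_step (x : \bar R) :
  (fun N => step N (fun s => (s%:E <= x)%E) t) @ \oo -->
  (if (t%:E <= x)%E then expR (- (4 * t ^+ 2)) else 0).
Proof.
have stepE : \forall N \near \oo, step N (fun s => (s%:E <= x)%E) t =
    if ((a N)%:E <= x)%E then rel_weight R N (cell N) else 0.
  near=> N; have [cN tc] : (cell N < N)%N /\ grid R N (cell N) <= t < grid R N (cell N).+1.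
    by near: N; exact: near_cell.
  exact: (step_cell _ cN tc).
case: ifPn => [tx|]; last rewrite -ltNge => xt.
  apply: cvg_trans cvg_rel_weight; apply: near_eq_cvg; near=> N.
  have -> : step N (fun s => (s%:E <= x)%E) t =
    if ((a N)%:E <= x)%E then rel_weight R N (cell N) else 0 by near: N.
  rewrite ifT //; apply: le_trans tx; rewrite lee_fin.
  have [_ /andP[] //] : (cell N < N)%N /\ grid R N (cell N) <= t < grid R N (cell N).+1.
  by near: N; exact: near_cell.
apply: (@cvg_trans _ ((fun _ : nat => 0 : R) @ \oo)); last exact: cvg_cst.
apply: near_eq_cvg.
case: x xt stepE => [x|//|_ _]; last by near=> N; rewrite /step big1.
rewrite lte_fin => xt stepE; near=> N.
have -> : step N (fun s => (s%:E <= x%:E)%E) t =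
    if ((a N)%:E <= x%:E)%E then rel_weight R N (cell N) else 0 by near: N.
rewrite ifF //; apply/negbTE; rewrite -ltNge lte_fin.
by near: N; exact: cvgr_gt cvg_grid_cell _ xt.
Unshelve. all: by end_near. Qed.

End PointwiseLimit.

(** * Convergence in distribution *)

Section NormalLimit.
Variable R : realType.

Local Notation mu := (@lebesgue_measure R).
Local Notation mesh N := ((Num.sqrt (N.+1%:R : R))^-1).
Local Notation sigma := (Num.sqrt (8^-1 : R)).

Let sigma_neq0 : sigma != 0.
Proof. by rewrite gt_eqF // sqrtr_gt0 invr_gt0. Qed.

Lemma normal_pdf_eighth (t : R) :
  normal_pdf 0 sigma t = normal_peak sigma * expR (- (4 * t ^+ 2)).
Proof.
rewrite normal_pdfE // /normal_fun subr0; congr (_ * expR _).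
by rewrite sqr_sqrtr // -mulr_natr; field.
Qed.

Lemma measurable_step N (Q : pred R) : measurable_fun setT (step N Q).
Proof.
have -> : step N Q = (fun t => \sum_(j < N) if Q (grid R N j)
    then rel_weight R N j * \1_(`[grid R N j, grid R N j.+1[) t else 0).
  by apply/funext => t; rewrite /step big_mkcond/=.
apply: measurable_sum => j; case: (Q _); last exact: measurable_cst.
by apply: measurable_funM; [exact: measurable_cst|exact: measurable_indic].
Qed.

Lemma integral_step N (Q : pred R) :
  (\int[mu]_t (step N Q t)%:E = (mesh N * \sum_(j < N | Q (grid R N j)) rel_weight R N j)%:E)%E.
Proof.
have stepE (t : R) : (step N Q t)%:E = (\sum_(j < N) if Q (grid R N j)
    then (rel_weight R N j * \1_(`[grid R N j, grid R N j.+1[) t)%:E else 0)%E.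
  by rewrite /step -sumEFin [LHS]big_mkcond.
under eq_integral do rewrite stepE.
rewrite ge0_integral_sum //=; last 2 first.
- move=> j; case: (Q _) => //; apply/measurable_EFinP.
  by apply: measurable_funM; [exact: measurable_cst|exact: measurable_indic].
- move=> j t _; case: (Q _) => //.
  by rewrite lee_fin mulr_ge0 ?rel_weight_ge0 // indicE.
rewrite mulr_sumr -sumEFin [RHS]big_mkcond; apply: eq_bigr => j _.
case: (Q _); last by rewrite integral0.
under eq_integral do rewrite EFinM.
rewrite ge0_integralZl_EFin ?rel_weight_ge0 //; last first.
  by apply/measurable_EFinP; exact: measurable_indic.
rewrite integral_indic //= setIT lebesgue_measure_itv /= lte_fin gridS ltrDl mesh_gt0.
by rewrite -EFinB -EFinM mulrC; congr (_ * _)%:E; ring.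
Qed.

Lemma integrable_gauss : mu.-integrable setT (fun t => (expR (- t ^+ 2))%:E).
Proof.
pose s : R := Num.sqrt 2^-1.
have s0 : s != 0 by rewrite gt_eqF // sqrtr_gt0 invr_gt0.
have p0 : normal_peak s != 0 by rewrite gt_eqF // normal_peak_gt0.
have -> : (fun t => (expR (- t ^+ 2))%:E) =
    (fun t => ((normal_peak s)^-1)%:E * (normal_pdf 0 s t)%:E)%E.
  apply/funext => t; rewrite normal_pdfE // /normal_fun subr0 -EFinM mulKf //.
  by congr (expR _)%:E; rewrite sqr_sqrtr // -mulr_natr; field.
by apply: integrableZl => //; exact: integrable_normal_pdf.
Qed.

Lemma measurable_lee_ray (x : \bar R) : measurable [set t : R | (t%:E <= x)%E].
Proof.
pose A y := [set t : R | (t%:E <= y)%E]; rewrite -/(A x); case: x => [r||].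
- suff -> : A r%:E = `]-oo, r]%classic by exact: measurable_itv.
  by apply/seteqP; split=> t; rewrite /A /= in_itv /= lee_fin.
- by suff -> : A +oo%E = setT by []; apply/seteqP; split=> t //= _; rewrite /A /= leey.
- by suff -> : A -oo%E = set0 by []; apply/seteqP; split.
Qed.

(** The mesh times the sum is the integral of a step function, so dominated convergence applies. *)
Lemma cvg_sum_rel_weight (x : \bar R) :
  (fun N => normal_peak sigma *
     (mesh N * \sum_(j < N | ((grid R N j)%:E <= x)%E) rel_weight R N j)) @ \oo -->
  fine (normal_prob 0 sigma [set t : R | (t%:E <= x)%E]).
Proof.
pose Q s := (s%:E <= x)%E; pose A := [set t : R | (t%:E <= x)%E].
have QA t : (t \in A) = Q t by apply/idP/idP; rewrite inE.
have mA : measurable A by exact: measurable_lee_ray.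
have mG : measurable_fun setT (fun t : R => (expR (- (4 * t ^+ 2)))%:E).
  apply/measurable_EFinP; apply: measurableT_comp => //; apply: measurableT_comp => //.
  by apply: measurable_funM => //; exact: measurable_funX.
have lim : (\int[mu]_t (step N Q t)%:E)%E @[N --> \oo] -->
    (\int[mu]_(t in A) (expR (- (4 * t ^+ 2)))%:E)%E.
  rewrite [X in _ --> X]integral_mkcond.
  have [] // := @dominated_convergence _ _ R mu setT measurableT
    (fun N t => (step N Q t)%:E) ((fun t => (expR (- (4 * t ^+ 2)))%:E) \_ A)
    (fun t => ((expR (5 / 2))%:E * (expR (- t ^+ 2))%:E)%E).
  - by move=> N; apply/measurable_EFinP; exact: measurable_step.
  - by apply/(measurable_restrictT _ _).1 => //; exact: measurable_funTS.
  - apply: aeW => t _; rewrite patchE QA.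
    have := @cvg_step R t x; rewrite -/(Q t); case: ifP => _ h;
      by apply: cvg_EFin; [exact: nearW|exact: h].
  - by apply: integrableZl => //; exact: integrable_gauss.
  - apply: aeW => t N _; rewrite -EFinM /= lee_fin ger0_norm ?step_ge0 //.
    exact: step_le.
have p0 := normal_peak_ge0 sigma.
have normE : normal_prob 0 sigma A =
    ((normal_peak sigma)%:E * \int[mu]_(t in A) (expR (- (4 * t ^+ 2)))%:E)%E.
  rewrite /normal_prob -ge0_integralZl_EFin //.
  - by apply: eq_integral => t _; rewrite normal_pdf_eighth.
  - exact: measurable_funTS.
rewrite -/A normE; set L := (\int[mu]_(t in A) _)%E in lim normE *.
have L0 : (0 <= L)%E by apply: integral_ge0 => t _; rewrite lee_fin expR_ge0.
have Lfin : L \is a fin_num.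
  (* An infinite integral times the positive peak would make a probability infinite. *)
  have : (normal_prob 0 sigma A : \bar R) \is a fin_num by rewrite fin_num_measure.
  rewrite normE; case: L L0 {lim normE} => [r||] //= _.
  by rewrite gt0_muley // lte_fin normal_peak_gt0.
rewrite fineM //=; apply: cvgM; first exact: cvg_cst.
move: lim; rewrite -(fineK Lfin) => /fine_cvg.
by under eq_fun do rewrite /= integral_step.
Qed.

End NormalLimit.

Section CentralLimit.
Variable R : realType.
Local Notation sigma := (Num.sqrt (8^-1 : R)).

Lemma normalized_grid m (t : perm_tuple m.+1) :
  (0 < nb_a_values t)%N ->
  normalized_nb_a_values R t = grid R m (nb_a_values t).-1.
Proof.
move=> t0; rewrite /normalized_nb_a_values /grid; congr (_ * _).
by rewrite /deviation -[in LHS](prednK t0) -[_.-1.+1%:R]natr1 -[m.+1%:R]natr1; field.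
Qed.

(** Quotient of the previous limit at x and at [+oo], where it is 1; the peak, the mesh and the
    central weight cancel. *)
Lemma cvg_sum_weight_ratio (x : R) :
  (fun m => (\sum_(j < m | grid R m j <= x) weight R m j) / (\sum_(j < m) weight R m j))
    @ \oo --> fine (normal_prob 0 sigma `]-oo, x]%classic).
Proof.
have cvg1 := @cvg_sum_rel_weight R x%:E; have cvg2 := @cvg_sum_rel_weight R +oo%E.
have e1 : [set t : R | (t%:E <= x%:E)%E] = `]-oo, x]%classic.
  by apply/seteqP; split=> t /=; rewrite in_itv /= lee_fin.
have e2 : [set t : R | (t%:E <= +oo)%E] = setT.
  by apply/seteqP; split=> t //= _; rewrite leey.
rewrite e1 in cvg1; rewrite e2 probability_setT /= in cvg2.
have -> : fine (normal_prob 0 sigma `]-oo, x]%classic) =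
    fine (normal_prob 0 sigma `]-oo, x]%classic) * 1^-1 by rewrite invr1 mulr1.
apply: cvg_trans (cvgM cvg1 (cvgV (oner_neq0 R) cvg2)); apply: near_eq_cvg.
near=> m => /=.
have m0 : (0 < m)%N by near: m; exact: nbhs_infty_gt.
have h0 : weight R m m./2 != 0 by rewrite gt_eqF // weight_gt0 //; lia.
have s0 : \sum_(j < m) weight R m j != 0.
  by rewrite gt_eqF // (bigD1 (Ordinal m0)) //= ltr_wpDr ?weight_gt0 // sumr_ge0 //.
have p0 : normal_peak sigma != 0.
  by rewrite gt_eqF // normal_peak_gt0 // gt_eqF // sqrtr_gt0 invr_gt0.
have e0 := mesh_gt0 R m; have {}e0 := negbT (gt_eqF e0).
have Q1 (j : 'I_m) : ((grid R m j)%:E <= +oo)%E = true by rewrite leey.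
have Qx (j : 'I_m) : ((grid R m j)%:E <= x%:E)%E = (grid R m j <= x) by rewrite lee_fin.
rewrite (eq_bigl _ _ Q1) (eq_bigl _ _ Qx) -!mulr_suml.
set S := \sum_(j < m) _ in s0 *; set S' := \sum_(_ | _) _.
set w := weight R m m./2 in h0 *; clearbody S S' w.
by rewrite invr_eq0 in e0; field; rewrite s0 h0 e0 p0.
Unshelve. all: by end_near. Qed.

Lemma cvg_normalized_nb_a_values (d : nat -> measure_display)
    (T : forall n, measurableType (d n)) (P : forall n, probability (T n) R)
    (tau : forall n, {RV (P n) >-> perm_tuple n}) :
  (forall n, (2 <= n)%N -> uniform_decreasing_factorization (tau n)) ->
  cvg_in_distribution
    (fun n => @normalized_nb_a_values R n \o tau n : {RV (P n) >-> R})
    (normal_prob 0 sigma).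
Proof.
move=> unif x _.
have Fx : normal_prob 0 sigma `]-oo, x]%classic \is a fin_num by rewrite fin_num_measure.
pose ratio m : R :=
  (\sum_(j < m | grid R m j <= x) weight R m j) / (\sum_(j < m) weight R m j).
have lim : (ratio m)%:E @[m --> \oo] --> normal_prob 0 sigma `]-oo, x]%classic.
  by rewrite -(fineK Fx); apply: cvg_EFin; [exact: nearW|exact: cvg_sum_weight_ratio].
(* With n = m+1 there are m factors, and m is the N of the weights. *)
rewrite -cvg_shiftS /=; apply: cvg_trans lim; apply: near_eq_cvg; near=> m => /=.
have m0 : (0 < m)%N by near: m; exact: nbhs_infty_gt.
(* Positivity makes the predecessor in k = j+1 exact. *)
have nb_gt0 (t : perm_tuple m.+1) : (0 < nb_a_values t)%N.
  rewrite /nb_a_values /a_values; case: t => -[|s t] tm /=.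
    by have /= e := eqP tm; rewrite -e in m0.
  have : lo s \in undup (map (@lo _) (s :: t)) by rewrite mem_undup mem_head.
  by rewrite /=; case: ifP => // _; case: (undup _).
have := @prob_nb_a_values_ratio R _ _ _ m.+1 (tau m.+1) m0 (unif m.+1 m0)
  (fun k => grid R m k.-1 <= x).
rewrite /= -/(ratio m) => <-.
rewrite /cdf /distribution /pushforward /=; congr (P _ _).
by apply/seteqP; split=> w /=; rewrite in_itv /= normalized_grid.
Unshelve. all: by end_near. Qed.

End CentralLimit.

Theorem proposition1 (R : realType) :
  (forall (n : nat) (d : measure_display) (T : measurableType d)
      (P : probability T R) (tau : {RV P >-> perm_tuple n}),
    (2 <= n)%N -> uniform_decreasing_factorization tau ->
    {ae P, forall w, b_values (tau w) =i [pred b | (2 <= b <= n)%N]} /\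
    (forall k : nat, (1 <= k <= n.-1)%N ->
      P [set w | nb_a_values (tau w) = k] =
        (n%:R / n.-1%:R * 'C(n.-1, k)%:R * 'C(n.-1, k.-1)%:R
          / 'C(2 * n.-1, n.-1)%:R)%:E)) /\
  (forall (d : nat -> measure_display) (T : forall n, measurableType (d n))
      (P : forall n, probability (T n) R)
      (tau : forall n, {RV (P n) >-> perm_tuple n}),
    (forall n, (2 <= n)%N -> uniform_decreasing_factorization (tau n)) ->
    cvg_in_distribution
      (fun n => @normalized_nb_a_values R n \o tau n : {RV (P n) >-> R})
      (normal_prob 0 (Num.sqrt (8^-1)))).
Proof.
split=> [n d T P tau n_gt1 unif|d T P tau]; last exact: cvg_normalized_nb_a_values.
split; first exact: ae_b_values.
by move=> k; exact: prob_nb_a_values_eq.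
Qed.
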